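(* Let $(\phi_i)_{i\ge 1}$ be a sequence of unit vectors, where $\phi_i$ lies in a finite-dimensional complex Hilbert space $\mathcal{H}_i$ with a fixed orthonormal basis $\{|x\rangle : x\in X_i\}$ ($X_i$ a finite set), and write $\phi_i=\sum_{x\in X_i} c_i(x)\,|x\rangle$. For each $N\ge 1$ let $\Omega_N=\phi_1\otimes\cdots\otimes\phi_N\in \mathcal{H}_1\otimes\cdots\otimes\mathcal{H}_N$. Suppose there is a constant $M$ such that $\mathrm{Var}\big(\ln|c_i(x_i)|^2\big)<M$ for all $i\ge 1$. For $\epsilon>0$, let $(\Omega_N)_{\mathrm{M}}$ be the orthogonal projection of $\Omega_N$ onto the span of the non-typical basis vectors, i.e. those $|x_1\rangle\otimes\cdots\otimes|x_N\rangle$ for which $$\left|-\frac1N\ln\big|c_{x_1\dots x_N}\big|^2-H_N\right|>\epsilon .$$ Then for every $N\ge 1$ and every $\epsilon>0$, $$\big\|(\Omega_N)_{\mathrm{M}}\big\|^2\le \frac{M}{N\epsilon^2},$$ and consequently, for every fixed $\epsilon>0$, $\lim_{N\to\infty}\big\|(\Omega_N)_{\mathrm{M}}\big\|^2=0$.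
   Context: Notation. $c_{x_1\dots x_N}=\prod_{i=1}^N c_i(x_i)$ is the coefficient of $|x_1\rangle\otimes\cdots\otimes|x_N\rangle$ in $\Omega_N$. The variance of $\ln|c_i(x_i)|^2$ is taken with respect to the weights $|c_i(x)|^2$ (which sum to $1$ over $x \in X_i$): $$\mathrm{Var}\big(\ln|c_i(x_i)|^2\big)=\sum_{x}|c_i(x)|^2\big(\ln|c_i(x)|^2-m_i\big)^2,\qquad m_i=\sum_{x}|c_i(x)|^2\ln|c_i(x)|^2 ,$$ where the sums run over those $x\in X_i$ with $c_i(x)\neq 0$. The Shannon entropy rate is $$H_N=-\frac1N\sum_{(x_1,\dots,x_N)}|c_{x_1\dots x_N}|^2\ln|c_{x_1\dots x_N}|^2,$$ with the convention $0\ln 0=0$. Basis vectors with $c_{x_1\dots x_N}=0$ have $-\ln|c_{x_1\dots x_N}|^2=+\infty$ and so count as non-typical; their coefficient in $\Omega_N$ is $0$. *)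

(* Defs.v *)
From HB Require Import structures.
From mathcomp Require Import all_boot all_order all_algebra.
From mathcomp Require Import sesquilinear complex.
From mathcomp Require Import all_classical all_reals all_analysis.

Set Implicit Arguments.
Unset Strict Implicit.
Unset Printing Implicit Defensive.

Import Order.TTheory GRing.Theory Num.Theory.
Import numFieldNormedType.Exports.

Local Open Scope ring_scope.
Local Open Scope complex_scope.

(* A finite-dimensional complex Hilbert space is a [V : vectType R[i]] with a
   positive definite Hermitian form [dot : {dot V for Num.conj}], linear in its
   first argument and conjugate-linear in the second. *)
Section HilbertSpace.
Variables (R : realType) (V : vectType R[i]) (dot : {dot V for @Num.conj R[i]}).

Definition hnorm (u : V) : R := Num.sqrt (complex.Re (dot u u)).

(* Repetitions in [codom e] are excluded by [orthonormal], so [e] is injective. *)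
Definition orthonormal_basis (X : finType) (e : X -> V) : Prop :=
  orthonormal dot (codom e) /\ <<codom e>>%VS = fullv.

(* [daddv_pi U W] is the projection onto [U] along [W]. *)
Definition orth_proj (U : {vspace V}) : V -> V := daddv_pi U (orthov dot U).

End HilbertSpace.

(* [T] with the map [tens : (u_i)_i |-> \bigotimes_i u_i] is a tensor product of
   the Hilbert spaces [H i]; such a [T] is unique up to a unique isometry
   compatible with [tens], and [hilbert_tensor_exists] below constructs one. *)
Section HilbertTensor.
Variables (R : realType) (I : finType) (H : I -> vectType R[i]).
Variable dot : forall i, {dot H i for @Num.conj R[i]}.
Variables (T : vectType R[i]) (dotT : {dot T for @Num.conj R[i]}).
Variable tens : (forall i, H i) -> T.

Definition multilinear : Prop :=
  forall (u : forall i, H i) (i : I) (a : R[i]) (v w : H i),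
    tens (dfwith u i (a *: v + w)) = a *: tens (dfwith u i v) + tens (dfwith u i w).

Definition hilbert_tensor : Prop :=
  [/\ multilinear,
      forall u v, dotT (tens u) (tens v) = \prod_i dot i (u i) (v i)
    & forall U : {vspace T}, (forall u, tens u \in U) -> U = fullv].

End HilbertTensor.

Lemma prod_sum_dffun (K : comNzRingType) (I : finType) (Y : I -> finType)
    (F : forall i, Y i -> K) :
  \prod_i \sum_(y : Y i) F i y =
  \sum_(x : {dffun forall i, Y i}) \prod_i F i (x i).
Proof.
rewrite (reindex (@dffun_of_fprod I Y)) /=; last first.
  exact/onW_bij/(Bijective (@dffun_of_fprodK I Y) (@fprod_of_dffunK I Y)).
transitivity (\sum_(t : fprod Y) \prod_i [ffun y => F i y] (t i)); last first.
  by apply: eq_bigr => t _; apply: eq_bigr => i _; rewrite !ffunE.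
rewrite big_fprod.
rewrite -(bigA_distr_big_dep _ (fun i j => untag 0 [ffun y => F i y] j)).
apply: eq_bigr => i _; rewrite -(big_tag (fun i y => [ffun y => F i y] y)).
by apply: eq_bigr => y _; rewrite ffunE.
Qed.

Section HilbertTensorExists.
Variable R : realType.
Local Notation C := R[i].

Lemma onb_expand (V : vectType C) (dot : {dot V for @Num.conj C})
  (X : finType) (e : X -> V) (u : V) : orthonormal_basis dot e ->
  (forall x y, dot (e x) (e y) = (x == y)%:R) /\
  u = \sum_x dot u (e x) *: e x.
Proof.
case=> on sp; have /orthonormalP[un oe] := on.
have inj : injective e by apply/injectiveP; rewrite /injectiveb /dinjectiveb.
have exy x y : dot (e x) (e y) = (x == y)%:R.
  by rewrite oe ?codom_f// (inj_eq inj).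
split=> //.
have fr := orthonormal_free on.
have := memvf u; rewrite -sp span_def big_map big_enum => /memv_sumP[v vP ->].
have vE x : exists a, v x = a *: e x by apply/vlineP; apply: vP.
have : exists a : X -> C, forall x, v x = a x *: e x.
  by exists (fun x => projT1 (cid (vE x))) => x; case: cid.
case=> a aE.
rewrite (eq_bigr (fun x => a x *: e x)) => [|x _]; last exact: aE.
apply: eq_bigr => x _; rewrite linear_sumlz; congr (_ *: _).
rewrite (bigD1 x)//= linearZl_LR /= exy eqxx mulr1 big1 ?addr0// => y yx.
by rewrite linearZl_LR /= exy (negbTE yx) mulr0.
Qed.

Lemma parseval (V : vectType C) (dot : {dot V for @Num.conj C})
  (X : finType) (e : X -> V) (u v : V) : orthonormal_basis dot e ->
  dot u v = \sum_x dot u (e x) * Num.conj (dot v (e x)).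
Proof.
move=> onb; have [_ {1}->] := onb_expand u onb.
rewrite linear_sumlz; apply: eq_bigr => x _.
by rewrite linearZl_LR /=; congr (_ * _); rewrite hermC expr0 mul1r.
Qed.

Section CoordSpace.
Variable Z : finType.
Definition coord_space := {ffun Z -> C^o}.
HB.instance Definition _ := Vector.on coord_space.
Definition coord_dot (f g : coord_space) : C := \sum_x f x * Num.conj (g x).
Lemma coord_dot_bil : bilinear_for (GRing.Scale.Law.clone _ _ ( *%R ) _)
  (GRing.Scale.Law.clone _ _ (@Num.conj C \; *%R ) _) coord_dot.
Proof.
split=> [v|u] a f g /=; rewrite /coord_dot.
  rewrite mulr_sumr -big_split /=; apply: eq_bigr => x _.
  by rewrite !ffunE mulrDl mulrA.
rewrite mulr_sumr -big_split /=; apply: eq_bigr => x _.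
by rewrite !ffunE rmorphD rmorphM mulrDr mulrCA.
Qed.
HB.instance Definition _ := bilinear_isBilinear.Build C coord_space coord_space C _ _ coord_dot coord_dot_bil.
Lemma coord_dot_herm f g : coord_dot f g = (-1) ^+ false * Num.conj (coord_dot g f).
Proof.
rewrite expr0 mul1r rmorph_sum; apply: eq_bigr => x _.
by rewrite rmorphM /= conjCK mulrC.
Qed.
HB.instance Definition _ := isHermitianSesquilinear.Build C coord_space false _ coord_dot coord_dot_herm.
Lemma coord_dot_pos f : f != 0 -> 0 < coord_dot f f.
Proof.
move=> f0; rewrite lt_neqAle.
have ge x : 0 <= f x * Num.conj (f x) by rewrite -normCK exprn_ge0.
rewrite sumr_ge0 // andbT eq_sym psumr_eq0 //; apply: contra f0 => /allP h.
apply/eqP/ffunP => x; rewrite ffunE; apply/eqP.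
by have := h x (mem_index_enum _); rewrite -normCK /= sqrf_eq0 normr_eq0.
Qed.
HB.instance Definition _ := isDotProduct.Build C coord_space coord_dot coord_dot_pos.
End CoordSpace.

Lemma hilbert_tensor_exists (I : finType) (H : I -> vectType C)
    (dot : forall i, {dot (H i) for @Num.conj C}) (X : I -> finType)
    (e : forall i, X i -> H i) :
    (forall i, orthonormal_basis (dot i) (e i)) ->
  exists (T : vectType C) (dotT : {dot T for @Num.conj C})
         (tens : (forall i, H i) -> T), hilbert_tensor dot dotT tens.
Proof.
move=> onb; pose Z : finType := {dffun forall i, X i}.
exists (coord_space Z), (@coord_dot Z : {dot _ for _}).
exists (fun u => [ffun x : Z => \prod_i dot i (u i) (e i (x i))]).
split.
- move=> u i a v w; apply/ffunP => x; rewrite !ffunE.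
  have h y : \prod_(j | j != i) dot j (dfwith u i y j) (e j (x j)) =
    \prod_(j | j != i) dot j (u j) (e j (x j)).
    by apply: eq_bigr => j ji; rewrite dfwithout // eq_sym.
  have D y : \prod_j dot j (dfwith u i y j) (e j (x j)) =
      dot i y (e i (x i)) * \prod_(j | j != i) dot j (u j) (e j (x j)).
    by rewrite (bigD1 i)//= dfwithin h.
  by rewrite !D linearPl /= mulrDl -mulrA.
- move=> u v; under [RHS]eq_bigr do rewrite (parseval _ _ (onb _)).
  rewrite prod_sum_dffun; apply: eq_bigr => x _.
  by rewrite !ffunE rmorph_prod big_split.
- move=> U UP; apply/eqP; rewrite eqEsubv subvf /=; apply/subvP => f _.
  have -> : f = \sum_(x : Z) f x *: ([ffun y : Z => (y == x)%:R] : coord_space Z).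
    apply/ffunP => y; rewrite sum_ffunE.
    transitivity (\sum_(x : Z) f x * (y == x)%:R).
      rewrite (bigD1 y isT).
      rewrite eqxx mulr1 big1 /= ?addr0 // => z zy.
      by rewrite eq_sym (negbTE zy) mulr0.
    by apply: eq_bigr => x _; rewrite ffunE ffunE.
  apply: rpred_sum => x _; apply: rpredZ.
  suff <- : [ffun y : Z => \prod_i dot i (e i (x i)) (e i (y i))] =
      ([ffun y : Z => (y == x)%:R] : coord_space Z) by exact: (UP (fun i => e i (x i))).
  apply/ffunP => y; rewrite ffunE [RHS]ffunE.
  transitivity (\prod_i ((x i == y i)%:R : C)).
    by apply: eq_bigr => i _; have [E _] := @onb_expand (H i) (dot i) (X i) (e i) 0 (onb i); rewrite E.
  have [->|yx] := eqVneq y x; first by rewrite big1 // => i _; rewrite eqxx.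
  have [i xi] : exists i, x i != y i.
    apply/existsP; rewrite -negb_forall; apply: contra yx => /forallP h.
    by apply/eqP/ffunP => i; apply/esym/eqP/h.
  by rewrite (bigD1 i)//= (negbTE xi) mul0r.
Qed.
End HilbertTensorExists.

Section Coefficients.
Variable R : realType.

Definition sqmod (z : R[i]) : R := ComplexField.Normc.normc z ^+ 2.

Section OneFactor.
Variables (X : finType) (c : X -> R[i]).

Definition log_mean : R := \sum_(x | c x != 0) sqmod (c x) * ln (sqmod (c x)).

Definition log_var : R :=
  \sum_(x | c x != 0) sqmod (c x) * (ln (sqmod (c x)) - log_mean) ^+ 2.

End OneFactor.

Section Product.
Variables (X : nat -> finType) (c : forall i, X i -> R[i]) (N : nat).

Definition multi_index := {dffun forall i : 'I_N, X i}.

Definition coef (x : multi_index) : R[i] := \prod_(i < N) c (x i).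

(* Terms with [coef x = 0] vanish because of the factor [sqmod (coef x)]. *)
Definition entropy_rate : R :=
  - N%:R^-1 * \sum_(x : multi_index) sqmod (coef x) * ln (sqmod (coef x)).

(* Since [ln 0 = 0] here, the case [-ln |coef x|^2 = +oo] is stated apart. *)
Definition nontypical (eps : R) (x : multi_index) : bool :=
  (coef x == 0) ||
  (eps < `| - N%:R^-1 * ln (sqmod (coef x)) - entropy_rate |).

End Product.
End Coefficients.

Definition nontypical_span (R : realType) (X : nat -> finType)
    (H : nat -> vectType R[i]) (e : forall i, X i -> H i)
    (c : forall i, X i -> R[i]) (N : nat) (T : vectType R[i])
    (tens : (forall i : 'I_N, H i) -> T) (eps : R) : {vspace T} :=
  <<[seq tens (fun i => e i (x i)) | x : multi_index X N in nontypical c eps]>>%VS.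

(* Main.v *)
Require Import Defs.
From HB Require Import structures.
From mathcomp Require Import all_boot all_order all_algebra.
From mathcomp Require Import sesquilinear complex ring.
From mathcomp Require Import all_classical all_reals all_analysis.

Set Implicit Arguments.
Unset Strict Implicit.
Unset Printing Implicit Defensive.

Import Order.TTheory GRing.Theory Num.Theory.
Import numFieldNormedType.Exports.

Local Open Scope classical_set_scope.
Local Open Scope ring_scope.
Local Open Scope complex_scope.

(** Only the isometry property of the tensor map matters: it makes the product
    basis vectors orthonormal, so the squared norm of the projection is the sum
    of [|coef x|^2] over non-typical [x].  Under the product weight
    [|coef x|^2] the quantity [ln |coef x|^2] is a sum of independent terms
    [ln |c_i(x_i)|^2] with mean [- N * H_N], whose variance is at most [N * M];
    the bound is then Chebyshev's inequality. *)
Section ProductWeight.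
Variables (K : comNzRingType) (I : finType) (Y : I -> finType).
Variable p : forall i, Y i -> K.
Arguments p : clear implicits.
Hypothesis p_sum1 : forall i, \sum_(y : Y i) p i y = 1.

Let P (x : {dffun forall i, Y i}) := \prod_i p i (x i).

(** Independence in moment form. A coordinate outside [A] is given the factor [1], so its sum is [1]
    by [p_sum1], and distributing the full product of sums yields the sum over all tuples. *)
Lemma sum_prod_weight_cond (A : pred I) (f : forall i, Y i -> K) :
  \sum_x P x * \prod_(i | A i) f i (x i) =
  \prod_(i | A i) \sum_(y : Y i) p i y * f i y.
Proof.
rewrite [RHS]big_mkcond /=.
transitivity (\prod_i \sum_(y : Y i) p i y * (if A i then f i y else 1));
  last first.
  apply: eq_bigr => i _; case: ifP => // _.
  by rewrite -[RHS](p_sum1 i); apply: eq_bigr => y _; rewrite mulr1.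
rewrite prod_sum_dffun; apply: eq_bigr => x _.
by rewrite [in LHS]big_mkcond -big_split.
Qed.

Lemma sum_prod_weight1 (f : forall i, Y i -> K) (i : I) :
  \sum_x P x * f i (x i) = \sum_(y : Y i) p i y * f i y.
Proof.
have := sum_prod_weight_cond (pred1 i) f.
rewrite big_pred1_eq => <-.
by apply: eq_bigr => x _; rewrite big_pred1_eq.
Qed.

(** The case where [A] is the pair [i], [j]; since [i != j], the product over [A] really has two
    factors. *)
Lemma sum_prod_weight2 (f : forall i, Y i -> K) (i j : I) : i != j ->
  \sum_x P x * (f i (x i) * f j (x j)) =
  (\sum_(y : Y i) p i y * f i y) * (\sum_(y : Y j) p j y * f j y).
Proof.
move=> ij.
have D (F : I -> K) : \prod_(k | (k == i) || (k == j)) F k = F i * F j.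
  rewrite (bigD1 i) ?eqxx //=; congr (_ * _); apply: big_pred1 => k /=.
  by case: (eqVneq k i) => [->|]; rewrite ?andbT ?andbF //= (negbTE ij).
have := sum_prod_weight_cond [pred k | (k == i) || (k == j)] f.
by rewrite D => <-; apply: eq_bigr => x _; rewrite D.
Qed.

(* Distinct coordinates are uncorrelated under the product weight. *)
Lemma variance_sum (f : forall i, Y i -> K) :
  (forall i, \sum_(y : Y i) p i y * f i y = 0) ->
  \sum_x P x * (\sum_i f i (x i)) ^+ 2 =
  \sum_i \sum_(y : Y i) p i y * f i y ^+ 2.
Proof.
move=> f0.
transitivity (\sum_i \sum_j \sum_x P x * (f i (x i) * f j (x j))).
  under [RHS]eq_bigr do rewrite exchange_big /=.
  rewrite exchange_big; apply: eq_bigr => x _.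
  rewrite expr2 mulr_suml mulr_sumr; apply: eq_bigr => i _.
  by rewrite mulr_sumr mulr_sumr.
apply: eq_bigr => i _.
rewrite (bigD1 i) //= [X in _ + X]big1 ?addr0; last first.
  move=> j ji; by rewrite sum_prod_weight2 1?eq_sym // f0 mul0r.
exact: (sum_prod_weight1 (fun i y => f i y ^+ 2)).
Qed.

End ProductWeight.

(** Chebyshev's inequality, termwise: on [A] the weight is at most [P x * S x ^+ 2 / eps ^+ 2]. The
    alternative [P x = 0] admits basis vectors with zero coefficient, which count as non-typical
    whatever their deviation. *)
Lemma chebyshev_sum (K : realFieldType) (Z : finType) (A : pred Z)
    (P S : Z -> K) (eps : K) : 0 < eps -> (forall x, 0 <= P x) ->
  (forall x, A x -> P x = 0 \/ eps < `|S x|) ->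
  \sum_(x | A x) P x <= (\sum_x P x * S x ^+ 2) / eps ^+ 2.
Proof.
move=> eps0 P0 AS; rewrite ler_pdivlMr ?exprn_gt0 // mulr_suml big_mkcond.
apply: ler_sum => x _; case: ifP => [/AS[->|lt_eps]|_].
- by rewrite !mul0r.
- rewrite ler_wpM2l // -(real_normK (num_real (S x))).
  by rewrite lerXn2r ?nnegrE ?normr_ge0 // ltW.
- by rewrite mulr_ge0 ?sqr_ge0.
Qed.

Section SquaredModulus.
Variable R : realType.
Implicit Types z : R[i].

Lemma sqmodE z : (sqmod z)%:C = z * Num.conj z.
Proof. by rewrite -normCK /sqmod rmorphXn. Qed.

Lemma sqmod_ge0 z : 0 <= sqmod z.
Proof. exact: sqr_ge0. Qed.

Lemma sqmod_eq0 z : (sqmod z == 0) = (z == 0).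
Proof.
by rewrite -(inj_eq (@complexI R)) sqmodE -normCK sqrf_eq0 normr_eq0.
Qed.

Lemma sqmod_prod (I : finType) (F : I -> R[i]) :
  sqmod (\prod_i F i) = \prod_i sqmod (F i).
Proof.
apply: complexI; rewrite sqmodE rmorph_prod -big_split rmorph_prod /=.
by apply: eq_bigr => i _; rewrite sqmodE.
Qed.

End SquaredModulus.

Lemma ln_prod (R : realType) (I : finType) (F : I -> R) :
  (forall i, 0 < F i) -> ln (\prod_i F i) = \sum_i ln (F i).
Proof.
(* Positivity is carried through the induction because [lnM] needs both factors positive. *)
move=> F0; have : 0 < \prod_i F i /\ ln (\prod_i F i) = \sum_i ln (F i).
  apply: (big_ind2 (fun a b => 0 < a /\ ln a = b)) =>
    [|a b a' b' [a0 <-] [a'0 <-]|i _].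
  - by rewrite ln1.
  - by split; [exact: mulr_gt0|rewrite lnM].
  - by split.
by case.
Qed.

(** * Orthogonal projection onto the span of an orthonormal family *)

Section OrthogonalProjection.
Variables (R : realType) (V : vectType R[i]) (dot : {dot V for @Num.conj R[i]}).

Lemma hnorm_sqr (u : V) : (hnorm dot u ^+ 2)%:C = dot u u.
Proof.
have := dnorm_ge0 dot u; rewrite /hnorm; case: (dot u u) => a b.
by rewrite lecE /= => /andP[/eqP-> a0]; rewrite sqr_sqrtr.
Qed.

Lemma cap_orthov (U : {vspace V}) : (U :&: orthov dot U = 0)%VS.
Proof.
apply/eqP; rewrite -subv0; apply/subvP => u; rewrite memv_cap => /andP[uU].
by move=> /mem_orthovP/(_ u uU)/eqP; rewrite dnorm_eq0 memv0.
Qed.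

(** Positive definiteness makes [U] meet its orthogonal complement only in [0], so the splitting of
    [w] into [u] and [w - u] is the only one. *)
Lemma orth_projE (U : {vspace V}) (w u : V) :
  u \in U -> w - u \in orthov dot U -> orth_proj dot U w = u.
Proof.
move=> uU wuU; rewrite /orth_proj -{1}(subrK u w) linearD /=.
rewrite [X in _ + X]daddv_pi_id ?cap_orthov //.
suff -> : daddv_pi U (orthov dot U) (w - u) = 0 by rewrite add0r.
have wuS : w - u \in (U + orthov dot U)%VS by exact: (subvP (addvSr _ _)).
(* The two projections of [w - u] add up to [w - u], and the one onto the complement already equals
   it. *)
have := daddv_pi_add (cap_orthov U) wuS.
rewrite [X in _ + X]daddv_pi_id 1?capvC ?cap_orthov //.
by move=> /(canRL (addrK _)) ->; rewrite subrr.
Qed.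

(** The projection is the partial Fourier sum [u] over [A]: [w] and [u] have the same inner product
    with each [b y], [y] in [A], so [w - u] is orthogonal to the span. *)
Lemma hnorm_orth_proj_span (Z : finType) (b : Z -> V) (A : pred Z) (w : V) :
  (forall x y, dot (b x) (b y) = (x == y)%:R) ->
  hnorm dot (orth_proj dot <<[seq b x | x in A]>>%VS w) ^+ 2 =
  \sum_(x in A) sqmod (dot w (b x)).
Proof.
move=> bo; pose u := \sum_(x in A) dot w (b x) *: b x.
have ub y : y \in A -> dot u (b y) = dot w (b y).
  move=> yA; rewrite /u linear_sumlz (bigD1 y) //= linearZl_LR /= bo eqxx mulr1.
  rewrite big1 ?addr0 // => x /andP[_ xy].
  by rewrite linearZl_LR /= bo (negbTE xy) mulr0.
have -> : orth_proj dot <<[seq b x | x in A]>>%VS w = u.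
  apply: orth_projE.
    apply: rpred_sum => x xA; apply: rpredZ; apply: memv_span.
    exact: fintype.image_f.
  apply/mem_orthovP => v; rewrite span_def.
  rewrite big_map big_enum_cond /= => /memv_sumP[v_ v_in ->].
  rewrite linear_sumr big1 //= => x xA; have /vlineP[k ->] := v_in x xA.
  by rewrite linearZr_LR /= linearBl /= ub ?subrr ?mulr0 //; case/andP: xA.
apply: complexI; rewrite hnorm_sqr {1}/u linear_sumlz rmorph_sum.
apply: eq_bigr => x xA; rewrite linearZl_LR /= sqmodE.
by congr (_ * _); rewrite hermC expr0 mul1r; congr Num.conj; exact: ub.
Qed.

End OrthogonalProjection.

(** * Weight of the non-typical multi-indices *)

Section TypicalityBound.
Variables (R : realType) (X : nat -> finType) (c : forall i, X i -> R[i]).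
Arguments c : clear implicits.
Hypothesis c_unit : forall i, \sum_(x : X i) sqmod (c i x) = 1.
Variable N : nat.

Let p (i : 'I_N) (y : X i) : R := sqmod (c i y).
Let L (i : 'I_N) (y : X i) : R := ln (p y).

Let p_sum1 (i : 'I_N) : \sum_(y : X i) p y = 1.
Proof. exact: c_unit. Qed.

Lemma sqmod_coef (x : multi_index X N) : sqmod (coef c x) = \prod_i p (x i).
Proof. exact: sqmod_prod. Qed.

Lemma ln_sqmod_coef (x : multi_index X N) : coef c x != 0 ->
  ln (sqmod (coef c x)) = \sum_i L (x i).
Proof.
move=> cx0; rewrite sqmod_coef ln_prod // => i.
rewrite lt_neqAle sqmod_ge0 eq_sym sqmod_eq0 andbT.
by apply: contra cx0; rewrite /coef => /eqP ci; rewrite (bigD1 i) //= ci mul0r.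
Qed.

Lemma log_mean_sum (i : nat) :
  log_mean (c i) = \sum_(y : X i) sqmod (c i y) * ln (sqmod (c i y)).
Proof.
rewrite /log_mean big_mkcond; apply: eq_bigr => y _; case: ifPn => // /negPn.
by rewrite -sqmod_eq0 => /eqP ->; rewrite mul0r.
Qed.

Lemma log_var_sum (i : nat) : log_var (c i) =
  \sum_(y : X i) sqmod (c i y) * (ln (sqmod (c i y)) - log_mean (c i)) ^+ 2.
Proof.
rewrite /log_var big_mkcond; apply: eq_bigr => y _; case: ifPn => // /negPn.
by rewrite -sqmod_eq0 => /eqP ->; rewrite mul0r.
Qed.

(** Additivity of Shannon entropy over a product: the logarithm becomes a sum, and each summand
    depends on one coordinate only. *)
Lemma entropy_rateE :
  entropy_rate c N = - N%:R^-1 * \sum_(i < N) log_mean (c i).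
Proof.
rewrite /entropy_rate; congr (_ * _).
transitivity (\sum_(x : multi_index X N) (\prod_i p (x i)) * \sum_i L (x i)).
  apply: eq_bigr => x _; rewrite -sqmod_coef.
  (* For a zero coefficient the logarithm need not split into a sum, but the weight in front
     vanishes. *)
  have [cx0|cx0] := boolP (coef c x == 0); last by rewrite ln_sqmod_coef.
  by move: cx0; rewrite -sqmod_eq0 => /eqP->; rewrite !mul0r.
under eq_bigr do rewrite mulr_sumr.
rewrite exchange_big; apply: eq_bigr => i _ /=.
by rewrite log_mean_sum (sum_prod_weight1 p_sum1 L).
Qed.

Lemma nontypical_weight_le (eps : R) : (0 < N)%N -> 0 < eps ->
  \sum_(x : multi_index X N | nontypical c eps x) sqmod (coef c x) <=
  (\sum_(i < N) log_var (c i)) / (N%:R * eps) ^+ 2.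
Proof.
move=> N0 eps0; have N0' : 0 < N%:R :> R by rewrite ltr0n.
(* The centred logarithms; their sum is, up to sign, [N] times the deviation from the entropy rate,
   hence the threshold [N%:R * eps]. *)
pose D (i : 'I_N) (y : X i) : R := L y - log_mean (c i).
have D0 (i : 'I_N) : \sum_(y : X i) p y * D i y = 0.
  under eq_bigr do rewrite mulrBr.
  by rewrite sumrB -mulr_suml p_sum1 mul1r log_mean_sum subrr.
have -> : \sum_(i < N) log_var (c i) =
    \sum_(x : multi_index X N) sqmod (coef c x) * (\sum_i D i (x i)) ^+ 2.
  under [RHS]eq_bigr do rewrite sqmod_coef.
  rewrite (variance_sum p_sum1 D0).
  by apply: eq_bigr => i _; rewrite log_var_sum.
apply: chebyshev_sum => [|x|x]; [exact: mulr_gt0|exact: sqmod_ge0|].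
move=> /orP[cx0|]; first by left; apply/eqP; rewrite sqmod_eq0.
(* The deviation inequality may also hold at a zero coefficient, where [ln 0 = 0]. *)
have [cx0 _|cx0] := eqVneq (coef c x) 0.
  by left; apply/eqP; rewrite sqmod_eq0 cx0.
rewrite entropy_rateE ln_sqmod_coef // -mulrBr -sumrB normrM normrN normfV.
by rewrite (gtr0_norm N0') ltr_pdivlMl // => ?; right.
Qed.

End TypicalityBound.

(** * Bound on the non-typical component and its limit *)

Theorem mainTheorem1 (R : realType) (X : nat -> finType)
    (H : nat -> vectType R[i])
    (dot : forall i, {dot (H i) for @Num.conj R[i]})
    (e : forall i, X i -> H i)
    (e_onb : forall i, orthonormal_basis (dot i) (e i))
    (phi : forall i, H i)
    (phi_unit : forall i, hnorm (dot i) (phi i) = 1)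
    (c : forall i, X i -> R[i])
    (phi_c : forall i, phi i = \sum_(x : X i) c i x *: e i x)
    (T : nat -> vectType R[i])
    (dotT : forall N, {dot (T N) for @Num.conj R[i]})
    (tens : forall N, (forall i : 'I_N, H i) -> T N)
    (T_tens : forall N, (0 < N)%N ->
      hilbert_tensor (fun i : 'I_N => dot i) (dotT N) (@tens N))
    (M : R) (var_lt : forall i, log_var (c i) < M) :
  let Omega N : T N := tens N (fun i : 'I_N => phi i) in
  let OmegaM N (eps : R) : T N :=
    orth_proj (dotT N) (nontypical_span e c (@tens N) eps) (Omega N) in
  (forall (N : nat) (eps : R), (0 < N)%N -> 0 < eps ->
     hnorm (dotT N) (OmegaM N eps) ^+ 2 <= M / (N%:R * eps ^+ 2)) /\
  (forall eps : R, 0 < eps ->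
     (fun N => hnorm (dotT N) (OmegaM N eps) ^+ 2) @ \oo --> (0 : R)).
Proof.
move=> Omega OmegaM.
have e_dot i x y : dot i (e i x) (e i y) = (x == y)%:R.
  by have [] := onb_expand 0 (e_onb i).
have phi_dot i x : dot i (phi i) (e i x) = c i x.
  rewrite phi_c linear_sumlz (bigD1 x) //= linearZl_LR /= e_dot eqxx mulr1.
  rewrite big1 ?addr0 // => y yx.
  by rewrite linearZl_LR /= e_dot (negbTE yx) mulr0.
have c_unit i : \sum_(x : X i) sqmod (c i x) = 1.
  apply: complexI; have := hnorm_sqr (dot i) (phi i).
  rewrite phi_unit expr1n (parseval _ _ (e_onb i)) => ->.
  by rewrite rmorph_sum; apply: eq_bigr => x _; rewrite phi_dot -sqmodE.
have bound (N : nat) (eps : R) : (0 < N)%N -> 0 < eps ->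
    hnorm (dotT N) (OmegaM N eps) ^+ 2 <= M / (N%:R * eps ^+ 2).
  move=> N0 eps0; have [_ tens_dot _] := T_tens N N0.
  have N0' : 0 < N%:R :> R by rewrite ltr0n.
  rewrite /OmegaM /nontypical_span hnorm_orth_proj_span; last first.
    move=> x y; rewrite tens_dot.
    have [->|xy] := eqVneq x y.
      by rewrite big1 // => i _; rewrite e_dot eqxx.
    (* Distinct multi-indices differ in some factor, which contributes a zero to the product of
       inner products. *)
    have [i xi] : exists i, x i != y i.
      apply/existsP; rewrite -negb_forall; apply: contra xy => /forallP h.
      by apply/eqP/ffunP => i; apply/eqP/h.
    by rewrite (bigD1 i) //= e_dot (negbTE xi) mul0r.
  have -> : \sum_(x : multi_index X N | nontypical c eps x)
      sqmod (dotT N (Omega N) (tens N (fun i => e i (x i)))) =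
      \sum_(x : multi_index X N | nontypical c eps x) sqmod (coef c x).
    apply: eq_bigr => x _; rewrite tens_dot; congr sqmod.
    by apply: eq_bigr => i _; rewrite phi_dot.
  apply: le_trans (nontypical_weight_le c_unit N0 eps0) _.
  (* The [N] variances sum to at most [N%:R * M], cancelling one factor of [N] in the Chebyshev
     denominator. *)
  have -> : M / (N%:R * eps ^+ 2) = (N%:R * M) / (N%:R * eps) ^+ 2.
    by field; rewrite !gt_eqF.
  rewrite ler_wpM2r ?invr_ge0 ?sqr_ge0 //.
  apply: (@le_trans _ _ (\sum_(i < N) M)).
    by apply: ler_sum => i _; exact: ltW.
  by rewrite sumr_const card_ord mulr_natl.
split=> // eps eps0.
apply: (@squeeze_cvgr _ _ _ _ (fun=> 0) (fun N => M / (N%:R * eps ^+ 2))).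
- near=> N; rewrite sqr_ge0 bound //.
  by near: N; exact: nbhs_infty_gt.
- exact: cvg_cst.
(* Shifting the index by one turns the inverse of [N] into the harmonic sequence. *)
rewrite -cvg_shiftS; under eq_fun do rewrite invfM mulrCA.
have := cvgM (@cvg_harmonic R) (cvg_cst (M / eps ^+ 2)).
by rewrite mul0r; apply.
Unshelve. all: by end_near.
Qed.
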